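(* Let $F:\mathbb R^m\to[0,+\infty)$ and $G:\mathbb R^n\to[0,+\infty)$ be positive-definite one-homogeneous convex functions, and let $T:\mathbb R^n\to\mathbb R^m$ be a nonzero linear map (regarded as a matrix $T\in\mathbb R^{m\times n}$). Then the eigenvalue problems of the function pairs $$(F\circ T,\,G),\quad (G^*\circ T^\top,\,F^* ),\quad (F\circ T,\,G_{\mathrm{Ker}(T)}),\quad (G^*_{\inf},\,F^* ),\quad (F,\,G_{\inf})$$ are equivalent in the sense that their nonzero eigenvalues are the same.
   Context: Positive-definite: $F(x)>0$ for $x\ne0$. One-homogeneous: $F(tx)=tF(x)$ for $t>0$. Dual function: $G^*(x)=\sup_{y\ne0}\langle x,y\rangle/G(y)$, similarly $F^*$. Projections: $G_{\inf}:\mathrm{Range}(T)\to\mathbb R$, $G_{\inf}(y)=\inf_{x\in T^{-1}(y)}G(x)$; $G_{\mathrm{Ker}(T)}:\mathbb R^n\to\mathbb R$, $G_{\mathrm{Ker}(T)}(x)=\inf_{z\in\mathrm{Ker}(T)}G(x+z)$. $G^*_{\inf}:\mathbb R^m\to\mathbb R$ is $G^*_{\inf}(x)=\sup\{\langle x,z\rangle:z\in\mathrm{Range}(T),\ G_{\inf}(z)\le1\}$. In the pair $(F,G_{\inf})$, $F$ is restricted to $\mathrm{Range}(T)$, the domain of $G_{\inf}$, and subdifferentials are taken in that subspace. $\lambda\in\mathbb R$ is an eigenvalue of a pair $(\Phi,\Psi)$ of convex functions if there is $x\ne0$ with $\nabla\Phi(x)\cap\lambda\nabla\Psi(x)\neq\varnothing$,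 where $\nabla$ is the (Clarke, equivalently convex) subdifferential; such $x$ is an eigenvector.
   Formalization: For the pair (F∘T, G_Ker(T)) eigenvectors are required to lie outside Ker(T), not merely to be nonzero; otherwise, whenever Ker(T) ≠ {0}, every real number is an eigenvalue of this pair and the claim fails. *)

(* Defs.v *)
From mathcomp Require Import all_boot all_order all_algebra.
From mathcomp Require Import all_classical all_reals.
From mathcomp Require Import convex.

Set Implicit Arguments.
Unset Strict Implicit.
Unset Printing Implicit Defensive.

Import Order.TTheory GRing.Theory Num.Theory.
Local Open Scope classical_set_scope.
Local Open Scope ring_scope.

Section Defs.
Variable R : realType.

Definition dot n (x y : 'cV[R]_n) : R := \sum_(i < n) x i 0 * y i 0.

Definition positive_definite n (F : 'cV[R]_n -> R) : Prop :=
  forall x, x != 0 -> 0 < F x.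

Definition one_homogeneous n (F : 'cV[R]_n -> R) : Prop :=
  forall (t : R) x, 0 < t -> F (t *: x) = t * F x.

Definition dual_fun n (G : 'cV[R]_n -> R) (x : 'cV[R]_n) : R :=
  sup [set dot x y / G y | y in [set y | y != 0]].

Section Projections.
Variables (m n : nat) (T : 'M[R]_(m, n)) (G : 'cV[R]_n -> R).

Definition Range : set 'cV[R]_m := range (mulmx T).

Definition Ker : set 'cV[R]_n := [set z | T *m z = 0].

(* Meaningful on [Range] only: [inf set0 = 0] elsewhere. *)
Definition Ginf (y : 'cV[R]_m) : R := inf [set G x | x in [set x | T *m x = y]].

Definition GKer (x : 'cV[R]_n) : R := inf [set G (x + z) | z in Ker].

Definition Ginf_dual (x : 'cV[R]_m) : R :=
  sup [set dot x z | z in [set z | Range z /\ Ginf z <= 1]].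

End Projections.

(* Convex subdifferential at [x] of the restriction of [Phi] to the linear
   subspace [V], as a subset of [V]. *)
Definition subdiff n (V : set 'cV[R]_n) (Phi : 'cV[R]_n -> R) (x : 'cV[R]_n) :
    set 'cV[R]_n :=
  [set p | V p /\ forall y, V y -> Phi x + dot p (y - x) <= Phi y].

Definition pair_eigenvector n (V : set 'cV[R]_n) (Phi Psi : 'cV[R]_n -> R) (lam : R)
    (x : 'cV[R]_n) : Prop :=
  [/\ V x, x != 0 &
      subdiff V Phi x `&` [set lam *: q | q in subdiff V Psi x] !=set0].

Definition pair_eigenvalue_in n (V : set 'cV[R]_n) (Phi Psi : 'cV[R]_n -> R)
    (lam : R) : Prop :=
  exists x, pair_eigenvector V Phi Psi lam x.

Definition pair_eigenvalue n (Phi Psi : 'cV[R]_n -> R) (lam : R) : Prop :=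
  pair_eigenvalue_in setT Phi Psi lam.

(* Eigenvalues of a pair of functions that are invariant under translations
   by the subspace [N]: eigenvectors must be nonzero modulo [N]. *)
Definition pair_eigenvalue_mod n (N : set 'cV[R]_n) (Phi Psi : 'cV[R]_n -> R)
    (lam : R) : Prop :=
  exists2 x, pair_eigenvector setT Phi Psi lam x & ~ N x.

(* [F \o mulmx T] and [GKer T G] both vanish on [Ker T], where 0 is a
   subgradient of both.  Unless eigenvectors in [Ker T] are discarded, every
   real number is thus an eigenvalue of this pair as soon as [Ker T] is
   nontrivial; when [Ker T] is trivial there is nothing to discard. *)
Lemma pair_eigenvalue_GKer_degenerate m n (F : 'cV[R]_m -> R) (G : 'cV[R]_n -> R)
    (T : 'M[R]_(m, n)) (z : 'cV[R]_n) (lam : R) :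
  (forall x, 0 <= F x) -> (forall x, 0 <= G x) ->
  one_homogeneous F -> one_homogeneous G ->
  z != 0 -> Ker T z -> pair_eigenvalue (F \o mulmx T) (GKer T G) lam.
Proof.
move=> F0 G0 hF hG z0 kz.
have hom0 k (H : 'cV[R]_k -> R) : one_homogeneous H -> H 0 = 0.
  move=> hH; have := hH 2 0 (ltr0n _ 2); rewrite scaler0 => /eqP.
  by rewrite mulr_natl mulr2n -subr_eq0 opprD addNKr oppr_eq0 => /eqP.
have ge0 x : 0 <= GKer T G x.
  apply: lb_le_inf; first by exists (G (x + 0)), 0 => //; rewrite /Ker /= mulmx0.
  by move=> _ [w _ <-].
have lbK : has_lbound [set G (z + w) | w in Ker T].
  by exists 0 => _ [w _ <-].
have Gz : GKer T G z = 0.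
  apply/eqP; rewrite eq_le ge0 andbT.
  apply: (ge_inf lbK); exists (- z); last by rewrite subrr hom0.
  by rewrite /Ker /= mulmxN kz oppr0.
have dot0 (y : 'cV[R]_n) : dot 0 y = 0.
  by rewrite /dot big1 // => i _; rewrite mxE mul0r.
exists z; split => //; exists 0; split.
  by split=> // y _; rewrite /= kz hom0 // dot0 addr0.
exists 0; last by rewrite scaler0.
by split=> // y _; rewrite Gz dot0 addr0.
Qed.

Lemma pair_eigenvalue_mod0 n (N : set 'cV[R]_n) (Phi Psi : 'cV[R]_n -> R) (lam : R) :
  N = [set 0] -> pair_eigenvalue_mod N Phi Psi lam <-> pair_eigenvalue Phi Psi lam.
Proof.
move=> ->; split=> [[x xe _]|[x xe]]; first by exists x.
by exists x => //= x0; case: xe => _ /eqP.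
Qed.

End Defs.

(* Main.v *)
Require Import Defs.
From mathcomp Require Import all_boot all_order all_algebra.
From mathcomp Require Import all_classical all_reals.
From mathcomp Require Import interval_inference convex topology normedtype derive.
From mathcomp Require Import lra.

(** Call gauge a positive definite sublinear function. In finite dimension a
    gauge [N] is coercive, so that its dual function is again a gauge and the
    infimum of [N] over a closed set is attained. The proof has two halves.

    Duality. A subgradient of a sublinear function [N] at [x] is a functional
    below [N] that touches it at [x] ([subdiff_sublinear]), a relation that is
    symmetric in the point and the functional up to normalization. If [x] is an
    eigenvector of the first pair, Hahn-Banach writes the common subgradient as
    [T^T *m u] with [u] a subgradient of [F] at [T *m x], and [u] is an
    eigenvector of the dual pair for the same eigenvalue
    ([pair_eigenvalue_dual]). Since a gauge equals its bidual ([dual_funK]),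
    applying this to the dual pair gives the converse. The fourth pair is the
    dual pair itself: [Ginf_dual T G = dual_fun G \o mulmx T^T] ([Ginf_dualE]).

    Projection. A subgradient of [F \o mulmx T] vanishes on the kernel of [T]; for a
    nonzero eigenvalue so does the subgradient of [G] proportional to it, which
    therefore cannot distinguish [G] from its infimum over cosets of the kernel,
    provided that the eigenvector is the point of its coset where that infimum
    is attained ([pair_eigenvalue_GKer]). Functionals vanishing on the kernel
    are the [T^T *m w] with [w] in the range of [T] ([dot_Ker]), which turns the
    problem modulo the kernel into the problem on the range
    ([pair_eigenvalue_Ginf]). *)

Import Order.TTheory GRing.Theory Num.Theory numFieldNormedType.Exports.
Local Open Scope classical_set_scope.
Local Open Scope ring_scope.

Set Implicit Arguments.
Unset Strict Implicit.

(** * The pairing on column vectors *)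

Section Dot.
Context {R : realType}.

Lemma dotE n (x y : 'cV[R]_n) : dot x y = (x^T *m y) 0 0.
Proof. by rewrite /dot mxE; apply: eq_bigr => i _; rewrite mxE. Qed.

Lemma dotC n (x y : 'cV[R]_n) : dot x y = dot y x.
Proof. by apply: eq_bigr => i _; rewrite mulrC. Qed.

Lemma dotDr n (x y z : 'cV[R]_n) : dot x (y + z) = dot x y + dot x z.
Proof. by rewrite !dotE mulmxDr mxE. Qed.

Lemma dotZr n a (x y : 'cV[R]_n) : dot x (a *: y) = a * dot x y.
Proof. by rewrite !dotE -scalemxAr mxE. Qed.

Lemma dotNr n (x y : 'cV[R]_n) : dot x (- y) = - dot x y.
Proof. by rewrite -scaleN1r dotZr mulN1r. Qed.

Lemma dotBr n (x y z : 'cV[R]_n) : dot x (y - z) = dot x y - dot x z.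
Proof. by rewrite dotDr dotNr. Qed.

Lemma dot0r n (x : 'cV[R]_n) : dot x 0 = 0.
Proof. by rewrite -[0](scale0r 0) dotZr mul0r. Qed.

Lemma dotDl n (x y z : 'cV[R]_n) : dot (x + y) z = dot x z + dot y z.
Proof. by rewrite dotC dotDr !(dotC z). Qed.

Lemma dotZl n a (x y : 'cV[R]_n) : dot (a *: x) y = a * dot x y.
Proof. by rewrite dotC dotZr dotC. Qed.

Lemma dotNl n (x y : 'cV[R]_n) : dot (- x) y = - dot x y.
Proof. by rewrite dotC dotNr dotC. Qed.

Lemma dotBl n (x y z : 'cV[R]_n) : dot (x - y) z = dot x z - dot y z.
Proof. by rewrite dotDl dotNl. Qed.

Lemma dot0l n (x : 'cV[R]_n) : dot 0 x = 0.
Proof. by rewrite dotC dot0r. Qed.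

Lemma dot_tr m n (A : 'M[R]_(m, n)) (u : 'cV[R]_m) (x : 'cV[R]_n) :
  dot (A^T *m u) x = dot u (A *m x).
Proof. by rewrite !dotE trmx_mul trmxK mulmxA. Qed.

Lemma dot_col m n (x y : 'cV[R]_m) (u v : 'cV[R]_n) :
  dot (col_mx x u) (col_mx y v) = dot x y + dot u v.
Proof. by rewrite !dotE tr_col_mx mul_row_col mxE. Qed.

Lemma dot_gt0 n (x : 'cV[R]_n) : x != 0 -> 0 < dot x x.
Proof.
move=> x0; rewrite lt_neqAle sumr_ge0 ?andbT => [|i _]; last exact: sqr_ge0.
apply: contra x0 => /eqP/esym/eqP; rewrite psumr_eq0 => [/allP x0|i _].
  apply/eqP/colP => i; rewrite mxE; apply/eqP; rewrite -sqrf_eq0 expr2.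
  exact: x0 (mem_index_enum i).
exact: sqr_ge0.
Qed.

Lemma dot_inj n (x y : 'cV[R]_n) : (forall z, dot x z = dot y z) -> x = y.
Proof.
move=> xy; apply/eqP; rewrite -subr_eq0; apply/negP => /negP/dot_gt0.
by rewrite dotBl xy subrr ltxx.
Qed.

(** A functional that vanishes on the kernel of [T] factors through [T]; since
    [T^T *m T] and [T] have the same kernel, its factor can moreover be chosen
    in the range of [T]. *)
Lemma dot_Ker m n (T : 'M[R]_(m, n)) (P : 'cV[R]_n) :
  (forall z, Ker T z -> dot P z = 0) -> exists2 w, Range T w & P = T^T *m w.
Proof.
move=> PK; have kerTT (k : 'cV[R]_n) : T^T *m (T *m k) = 0 -> T *m k = 0.
  move=> Tk; apply/eqP; apply/negP => /negP/dot_gt0.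
  by rewrite -dot_tr Tk dot0l ltxx.
suff /submxP[D PD] : (P^T <= T^T *m T)%MS.
  exists (T *m D^T); first by exists D^T.
  by rewrite -[P]trmxK PD !trmx_mul trmxK mulmxA.
rewrite submxE; move: (mulmx_coker (T^T *m T)).
move: (cokermx _) => K TK; apply/eqP/rowP => j.
have /PK : Ker T (col j K) by apply: kerTT; rewrite colE !mulmxA TK mul0mx.
by rewrite dotE colE mulmxA -colE !mxE.
Qed.

End Dot.

(** * Sublinear functions and the Hahn-Banach theorem *)

Section HahnBanach.
Context {R : realType}.

Definition sublinear n (N : 'cV[R]_n -> R) :=
  one_homogeneous N /\ forall x y, N (x + y) <= N x + N y.

Lemma sublinear0 n (N : 'cV[R]_n -> R) : sublinear N -> N 0 = 0.
Proof.
move=> [hN _]; have := hN 2 0 (ltr0n _ 2); rewrite scaler0.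
lra.
Qed.

Lemma dot_sublinear n (p : 'cV[R]_n) : sublinear (dot p).
Proof. by split=> [t x _|x y]; rewrite ?dotZr ?dotDr. Qed.

(** One-step extension to the direction [v]: the admissible values for [v] are
    those above all [dot c x - N (A *m x - v)] and below all
    [N (A *m x + v) - dot c x]; subadditivity leaves room for a supremum. *)
Lemma dominated_extension1 m n (N : 'cV[R]_m -> R) (A : 'M[R]_(m, n))
    (c : 'cV[R]_n) (v : 'cV[R]_m) : sublinear N ->
  (forall x, dot c x <= N (A *m x)) ->
  exists a, forall x t, dot c x + t * a <= N (A *m x + t *: v).
Proof.
move=> [hN sN] cN; pose S := [set dot c x - N (A *m x - v) | x in setT].
have ubS x : ubound S (N (A *m x + v) - dot c x).
  move=> _ [y _ <-]; have := cN (x + y).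
  have -> : A *m (x + y) = A *m x + v + (A *m y - v).
    by rewrite mulmxDr addrACA subrr addr0.
  by move/le_trans/(_ (sN _ _)); rewrite dotDr; lra.
have S0 : S !=set0 by exists (dot c 0 - N (A *m 0 - v)), 0.
have leS x : dot c x - N (A *m x - v) <= sup S.
  apply: ub_le_sup; last by exists x.
  by exists (N (A *m 0 + v) - dot c 0); exact: ubS.
exists (sup S) => x t; have [t0|t0|->] := ltgtP t 0; first last.
- by rewrite mul0r scale0r !addr0.
- have := ge_sup S0 (ubS (t^-1 *: x)).
  rewrite -(ler_pM2l t0) mulrBr -hN// scalerDr -dotZr scalemxAr !scalerA.
  by rewrite divff ?gt_eqF// !scale1r; lra.
have t0' : 0 < - t by rewrite oppr_gt0.
have := leS ((- t)^-1 *: x).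
rewrite -(ler_pM2l t0') mulrBr -hN// scalerBr -dotZr scalemxAr !scalerA.
by rewrite divff ?gt_eqF// !scale1r scaleNr opprK; lra.
Qed.

(** Adding the columns of [B] one at a time; the extended domain is encoded by
    the block matrix [row_mx A _], the extended functional by [col_mx c _]. *)
Lemma dominated_extension m n l (N : 'cV[R]_m -> R) (A : 'M[R]_(m, n))
    (c : 'cV[R]_n) (B : 'M[R]_(m, l)) : sublinear N ->
  (forall x, dot c x <= N (A *m x)) ->
  exists u, forall x y, dot c x + dot u y <= N (A *m x + B *m y).
Proof.
move=> Nsub; elim: l B n A c => [|l IH] B n A c cN.
  by exists 0 => x y; rewrite dot0l addr0 [y]flatmx0 mulmx0 addr0.
pose B1 : 'M_(m, 1 + l) := B.
have [a aN] := dominated_extension1 (lsubmx B1) Nsub cN.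
have acN (x : 'cV_(n + 1)) :
    dot (col_mx c a%:M) x <= N (row_mx A (lsubmx B1) *m x).
  rewrite -[x]vsubmxK dot_col mul_row_col [dsubmx x]mx11_scalar mul_mx_scalar.
  by rewrite [dot a%:M _]dotE tr_scalar_mx -scalar_mxM mxE eqxx mulr1n [a * _]mulrC.
have [u uN] := IH (rsubmx B1) _ _ _ acN.
exists (col_mx (a%:M : 'cV_1) u : 'cV_(1 + l)) => x y.
pose y1 : 'cV_(1 + l) := y.
have -> : dot (col_mx a%:M u) y1 = dot a%:M (usubmx y1) + dot u (dsubmx y1).
  by rewrite -dot_col vsubmxK.
have -> : B *m y = lsubmx B1 *m usubmx y1 + rsubmx B1 *m dsubmx y1.
  by rewrite -mul_row_col hsubmxK vsubmxK.
have := uN (col_mx x (usubmx y1)) (dsubmx y1).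
by rewrite dot_col mul_row_col !addrA.
Qed.

(** The functional [c] stands for a functional on the range of [A]; being
    dominated, it vanishes on the kernel of [A], so it really factors. Extending
    along the columns of the identity matrix gives [u] with
    [dot c x + dot u y <= N (A *m x + y)]: taking [x = 0] bounds [u] by [N], and
    [y = - (A *m x)], used at [x] and at [- x], makes [u] agree with [c]. *)
Lemma hahn_banach m n (N : 'cV[R]_m -> R) (A : 'M[R]_(m, n)) (c : 'cV[R]_n) :
  sublinear N -> (forall x, dot c x <= N (A *m x)) ->
  exists2 u, A^T *m u = c & forall y, dot u y <= N y.
Proof.
move=> Nsub cN; have [u uN] := dominated_extension 1%:M Nsub cN.
exists u => [|y]; last first.
  by have := uN 0 y; rewrite dot0r add0r mulmx0 add0r mul1mx.
have uA x : dot c x <= dot u (A *m x).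
  have := uN x (- (A *m x)); rewrite mul1mx subrr (sublinear0 Nsub) dotNr.
  by rewrite subr_le0.
apply: dot_inj => x; apply/eqP; rewrite eq_le dot_tr uA andbT.
by rewrite -lerN2 -!dotNr -mulmxN uA.
Qed.

End HahnBanach.

(** * Gauges, coercivity and attained infima *)

Section Gauges.
Context {R : realType}.

(** Norms without evenness. *)
Definition gauge n (N : 'cV[R]_n -> R) := positive_definite N /\ sublinear N.

Lemma gauge_convex n (N : 'cV[R]_n -> R) :
  positive_definite N -> one_homogeneous N ->
  @convex_function R 'cV[R]_n setT N -> gauge N.
Proof.
move=> pN hN cN; split=> //; split=> // x y.
(* By homogeneity, midpoint convexity is subadditivity. *)
have h0 : (0 : R) <= 2^-1 by lra.
have h1 : (2^-1 : R) <= 1 by lra.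
have := @cN (Itv01 h0 h1) x y (in_setT _) (in_setT _).
rewrite convRE /conv /=.
have -> : unstable.onem (2^-1 : R) = 2^-1 by rewrite /unstable.onem; lra.
by rewrite -scalerDr hN ?invr_gt0// -mulrDr ler_pM2l ?invr_gt0.
Qed.

Lemma gauge_ge0 n (N : 'cV[R]_n -> R) x : gauge N -> 0 <= N x.
Proof.
move=> [pN sN]; have [->|/pN/ltW//] := eqVneq x 0.
by rewrite (sublinear0 sN).
Qed.

Lemma sublinear_sum n (N : 'cV[R]_n -> R) (I : finType) (f : I -> 'cV[R]_n) :
  sublinear N -> N (\sum_i f i) <= \sum_i N (f i).
Proof.
move=> sN; elim/big_ind2 : _ => [|x a y b xa yb|//]; first by rewrite sublinear0.
by rewrite (le_trans (sN.2 _ _))// lerD.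
Qed.

(** Split [v] along the standard basis; a negative coordinate is charged to the
    opposite basis vector, as [N] need not be even. *)
Lemma sublinear_le_norm n (N : 'cV[R]_n -> R) : sublinear N ->
  exists2 C, 0 < C & forall v : 'rV[R]_n, N v^T <= C * `|v|.
Proof.
move=> sN; have [hN _] := sN; pose e i : 'cV[R]_n := delta_mx i 0.
pose C := \sum_i (`|N (e i)| + `|N (- e i)|).
have C0 : 0 <= C by apply: sumr_ge0 => i _; rewrite addr_ge0.
exists (C + 1) => [|v]; first by rewrite ltr_wpDl.
have -> : v^T = \sum_i v 0 i *: e i.
  apply/colP => i; rewrite mxE summxE (bigD1 i)//= big1 => [|j ji].
    by rewrite !mxE !eqxx mulr1 addr0.
  by rewrite !mxE eq_sym (negbTE ji) mulr0.
rewrite (le_trans (sublinear_sum _ sN))// (@le_trans _ _ (C * `|v|))//; last first.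
  by rewrite ler_wpM2r// lerDl.
rewrite mulr_suml ler_sum// => i _.
have vi : `|v 0 i| <= `|v|.
  rewrite [leRHS]/Num.Def.normr/= mx_normrE.
  by apply/bigmax_geP; right; exists (0, i).
apply: (@le_trans _ _ (`|v 0 i| * (`|N (e i)| + `|N (- e i)|))); last first.
  by rewrite mulrC ler_wpM2l// addr_ge0.
have [v0|v0|->] := ltgtP (v 0 i) 0.
- have -> : v 0 i *: e i = (- v 0 i) *: - e i by rewrite scalerN scaleNr opprK.
  rewrite ltr0_norm// hN ?oppr_gt0// ler_pM2l ?oppr_gt0//.
  by rewrite (le_trans (ler_norm _))// lerDr.
- rewrite gtr0_norm// hN// ler_pM2l//.
  by rewrite (le_trans (ler_norm _))// lerDl.
by rewrite scale0r normr0 mul0r (sublinear0 sN).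
Qed.

(** Sublinear functions are Lipschitz: [N u - N w <= N (u - w)]. Topological
    statements are phrased on row vectors, to which Heine-Borel
    applies. *)
Lemma sublinear_continuous n (N : 'cV[R]_n -> R) : sublinear N ->
  continuous (fun v : 'rV[R]_n => N v^T).
Proof.
move=> subN v; have [C C0 NC] := sublinear_le_norm subN; have [_ sN] := subN.
have lip u w : N u^T - N w^T <= C * `|u - w|.
  rewrite lerBlDr (le_trans _ (lerD (NC _) (lexx _)))//.
  by rewrite (le_trans _ (sN _ _))// -raddfD subrK.
rewrite /continuous_at; apply/(@cvgrPdist_le _ _ _ _ (nbhs_filter v)) => e e0.
have eC : 0 < e / C by rewrite divr_gt0.
have : \forall w \near nbhs v, `|v - w| <= e / C.
  exact: (@cvgr_dist_le _ _ _ (nbhs v) _ id v cvg_id).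
apply: filterS => w; rewrite ler_pdivlMr// mulrC => vw.
by rewrite ler_norml lerNl opprB !(le_trans (lip _ _))// distrC.
Qed.

(** The constant is the minimum of the gauge on the unit sphere, which is compact;
    homogeneity propagates the bound. *)
Lemma gauge_coercive n (N : 'cV[R]_n -> R) : gauge N ->
  exists2 c, 0 < c & forall v : 'rV[R]_n, c * `|v| <= N v^T.
Proof.
move=> gN; have [pN [hN _]] := gN; pose S := [set v : 'rV[R]_n | `|v| = 1].
have normed v : v != 0 -> S (`|v|^-1 *: v).
  by move=> v0; rewrite /S /= normrZ normfV normr_id mulVf// normr_eq0.
have [S0|S0] := pselect (S !=set0); last first.
  (* The sphere is empty in dimension 0 only. *)
  exists 1 => // v; have [->|/normed Sv] := eqVneq v 0.
    by rewrite normr0 mulr0 gauge_ge0.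
  by case: S0; eexists; exact: Sv.
have cS : compact S.
  apply: bounded_closed_compact.
    by exists 1; split; [exact: num_real|move=> M M1 v /= ->; exact: ltW].
  have -> : S = Num.Def.normr @^-1` [set 1] by [].
  apply: closed_comp => [v _|]; last exact: closed_eq.
  exact: norm_continuous.
have [c] := EVT_min_rV S0 cS (continuous_subspaceT (sublinear_continuous gN.2)).
rewrite inE => cS1 minc.
exists (N c^T) => [|v].
  apply: pN; rewrite trmx_eq0 -normr_eq0 cS1; exact: oner_neq0.
have [->|v0] := eqVneq v 0; first by rewrite normr0 mulr0 gauge_ge0.
have v1 : 0 < `|v| by rewrite normr_gt0.
have := minc _ (mem_set (normed _ v0)).
by rewrite linearZ/= hN ?invr_gt0// mulrC ler_pdivlMr.
Qed.

(** By coercivity the sublevel sets are bounded, so minimizing over the closed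
    set [A] amounts to minimizing over a compact part of it. *)
Lemma gauge_attains_min n (N : 'cV[R]_n -> R) (A : set 'rV[R]_n) : gauge N ->
  A !=set0 -> closed A ->
  exists2 v, A v & forall w, A w -> N v^T <= N w^T.
Proof.
move=> gN [a Aa] clA; have [c c0 cN] := gauge_coercive gN.
have Nc := sublinear_continuous gN.2.
pose B := A `&` [set v | N v^T <= N a^T].
have cB : compact B.
  apply: bounded_closed_compact.
    exists (N a^T / c); split; [exact: num_real|move=> M aM v /= [_ va]].
    by rewrite (le_trans _ (ltW aM))// ler_pdivlMr// mulrC (le_trans (cN _)).
  apply: closedI => //.
  apply: (@closed_comp _ _ (fun v : 'rV_n => N v^T) [set r | r <= N a^T]);
    last exact: closed_le.
  move=> v _.
  exact: Nc.
have B0 : B !=set0 by exists a; split=> /=.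
have [v] := EVT_min_rV B0 cB (continuous_subspaceT Nc).
rewrite inE => -[Av va] minv; exists v => // w Aw.
have [wa|/ltW aw] := leP (N w^T) (N a^T); last exact: le_trans aw.
by apply: minv; rewrite inE; split.
Qed.

Lemma GKer_GinfE m n (T : 'M[R]_(m, n)) (G : 'cV[R]_n -> R) x :
  GKer T G x = Ginf T G (T *m x).
Proof.
congr inf; apply/seteqP; split=> _ [y Ty <-].
  by exists (x + y) => //=; rewrite mulmxDr Ty addr0.
by exists (y - x); rewrite ?[x + _]addrC ?subrK// /Ker /= mulmxBr Ty subrr.
Qed.

(** The coset of [x] modulo [Ker T] is the fibre of [T] through [x], which is
    closed. *)
Lemma GKer_attained m n (T : 'M[R]_(m, n)) (G : 'cV[R]_n -> R) x : gauge G ->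
  exists2 z, Ker T z & G (x + z) = GKer T G x.
Proof.
move=> gG; pose A := [set v : 'rV[R]_n | T *m v^T = T *m x].
have A0 : A !=set0 by exists x^T; rewrite /A /= trmxK.
have clA : closed A.
  have -> : A = \bigcap_w ((fun v : 'rV[R]_n => dot (T^T *m w) v^T)
                              @^-1` [set dot w (T *m x)]).
    apply/seteqP; split=> v Av; first by move=> w _; rewrite /= dot_tr Av.
    by apply: dot_inj => w; rewrite dotC -dot_tr (Av w I) dotC.
  (* Each [dot (T^T *m w)] is sublinear, which makes it continuous. *)
  apply: closed_bigI => w _; apply: closed_comp => [v _|]; last exact: closed_eq.
  exact: (sublinear_continuous (dot_sublinear _)).
have [v Tv minv] := gauge_attains_min gG A0 clA.
have Kz : Ker T (v^T - x) by rewrite /Ker /= mulmxBr Tv subrr.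
exists (v^T - x) => //; rewrite addrC subrK.
apply/eqP; rewrite eq_le; apply/andP; split.
  apply: lb_le_inf; first by exists (G (x + (v^T - x))), (v^T - x).
  move=> _ [z Kz' <-]; rewrite -[x + z]trmxK; apply: minv.
  by rewrite /A /= trmxK mulmxDr Kz' addr0.
apply: ge_inf; last by exists (v^T - x) => //; rewrite addrC subrK.
by exists 0 => _ [z _ <-]; exact: gauge_ge0.
Qed.

End Gauges.

(** * Duality of gauges *)

Section Duality.
Context {R : realType}.

(** The supremum defining [dual_fun G] is only meaningful because the quotients
    are bounded: [dot q] grows at most linearly and [G] at least linearly. *)
Lemma dual_fun_ineq n (G : 'cV[R]_n -> R) q y : gauge G ->
  dot q y <= dual_fun G q * G y.
Proof.
move=> gG; have [->|y0] := eqVneq y 0.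
  by rewrite dot0r (sublinear0 gG.2) mulr0.
rewrite -ler_pdivrMr ?gG.1//; apply: ub_le_sup; last by exists y.
have [C C0 qC] := sublinear_le_norm (dot_sublinear q).
have [c c0 Gc] := gauge_coercive gG.
exists (C / c) => _ [x x0 <-]; rewrite ler_pdivrMr ?gG.1//.
have := qC x^T; have := Gc x^T; rewrite trmxK => Gx qx.
apply: (le_trans qx); rewrite -mulrA ler_pM2l// mulrC ler_pdivlMr//.
by rewrite mulrC.
Qed.

Lemma dual_fun_le n (G : 'cV[R]_n -> R) q a : gauge G -> 0 <= a ->
  (forall y, dot q y <= a * G y) -> dual_fun G q <= a.
Proof.
move=> gG a0 qa; rewrite /dual_fun; set S := [set _ | _ in _].
have [S0|] := pselect (S !=set0); last first.
  by move=> /set0P/negP/negPn/eqP ->; rewrite sup0.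
by apply: ge_sup => // _ [y y0 <-]; rewrite ler_pdivrMr ?gG.1.
Qed.

Lemma dual_fun_gt0 n (G : 'cV[R]_n -> R) q : gauge G -> q != 0 ->
  0 < dual_fun G q.
Proof.
move=> gG q0; rewrite -(pmulr_lgt0 _ (gG.1 q q0)).
by rewrite (lt_le_trans (dot_gt0 q0))// dual_fun_ineq.
Qed.

Lemma dual_fun0 n (G : 'cV[R]_n -> R) : gauge G -> dual_fun G 0 = 0.
Proof.
move=> gG; apply/eqP; rewrite eq_le dual_fun_le//=; last first.
  by move=> y; rewrite dot0l mul0r.
rewrite /dual_fun; set S := [set _ | _ in _].
have [[_ [y y0 _]]|] := pselect (S !=set0); last first.
  by move=> /set0P/negP/negPn/eqP ->; rewrite sup0.
by have := dual_fun_ineq 0 y gG; rewrite dot0l pmulr_lge0 ?gG.1.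
Qed.

Lemma dual_fun_ge0 n (G : 'cV[R]_n -> R) q : gauge G -> 0 <= dual_fun G q.
Proof.
move=> gG; have [->|q0] := eqVneq q 0; first by rewrite dual_fun0.
exact/ltW/dual_fun_gt0.
Qed.

Lemma dual_gauge n (G : 'cV[R]_n -> R) : gauge G -> gauge (dual_fun G).
Proof.
move=> gG; have D0 q := dual_fun_ge0 q gG.
split; first by move=> q; exact: dual_fun_gt0.
have leZ (t : R) q : 0 < t -> dual_fun G (t *: q) <= t * dual_fun G q.
  move=> t0; apply: dual_fun_le => //; first by rewrite mulr_ge0// ltW.
  by move=> y; rewrite dotZl -mulrA ler_pM2l// dual_fun_ineq.
split=> [t q t0|p q].
  apply/eqP; rewrite eq_le leZ//= -ler_pdivlMl//.
  rewrite -[X in dual_fun G X <= _](scalerK (lt0r_neq0 t0)).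
  by rewrite leZ ?invr_gt0.
apply: dual_fun_le; rewrite ?addr_ge0// => y.
by rewrite dotDl mulrDl lerD ?dual_fun_ineq.
Qed.

(** Bipolarity: Hahn-Banach along the line through [x] gives a functional
    below [G] that touches it at [x]. *)
Lemma dual_funK n (G : 'cV[R]_n -> R) : gauge G -> dual_fun (dual_fun G) = G.
Proof.
move=> gG; have gD := dual_gauge gG; apply/funext => x.
have Gx := gauge_ge0 x gG.
apply/eqP; rewrite eq_le dual_fun_le//=; last first.
  by move=> q; rewrite dotC mulrC dual_fun_ineq.
have [t|q qx qG] := @hahn_banach _ _ _ G x (G x)%:M gG.2.
  rewrite [t]mx11_scalar; move: (t 0 0) => {}t.
  rewrite mul_mx_scalar dotE tr_scalar_mx -scalar_mxM mxE eqxx mulr1n mulrC.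
  have [t0|t0|->] := ltgtP t 0.
  - have : 0 <= G (t *: x) + G (- t *: x).
      by rewrite addr_ge0 ?gauge_ge0.
    rewrite (gG.2.1 (- t)) ?oppr_gt0//; lra.
  - by rewrite gG.2.1.
  - by rewrite mul0r scale0r (sublinear0 gG.2).
have {}qx : dot q x = G x. by rewrite dotC dotE qx mxE eqxx mulr1n.
rewrite -{1}qx dotC (le_trans (dual_fun_ineq _ _ gD))// ler_piMr ?dual_fun_ge0//.
by apply: dual_fun_le => // y; rewrite mul1r.
Qed.

(** The subgradient inequality at [0] and [2 *: x] gives Euler's identity
    [dot p x = N x]; at [x + y], subadditivity then removes the base point. *)
Lemma subdiff_sublinear n (N : 'cV[R]_n -> R) x p : sublinear N ->
  subdiff setT N x p <-> (forall y, dot p y <= N y) /\ dot p x = N x.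
Proof.
move=> sN; split=> [[_ px]|[pN pxE]]; last first.
  by split=> // y _; rewrite dotBr pxE addrC subrK.
have p0 := px 0 I; have p2 := px (2 *: x) I.
rewrite sub0r dotNr (sublinear0 sN) in p0.
rewrite dotBr dotZr sN.1 ?ltr0n// in p2.
have pxE : dot p x = N x by lra.
split=> // y; have := px (x + y) I; have := sN.2 x y.
by rewrite [x + y]addrC addrK; lra.
Qed.

(** The chain rule of convex analysis, which is Hahn-Banach, writes a
    subgradient of [F \o T] at [x] as [T^T *m u] with [u] a subgradient of [F]
    at [T *m x]. The roles of points and subgradients are then exchanged by
    duality: [u] is an eigenvector of the dual pair, with subgradients
    [T *m x / G x] and [T *m x / F (T *m x)]. *)
Lemma pair_eigenvalue_dual m n (F : 'cV[R]_m -> R) (G : 'cV[R]_n -> R)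
    (T : 'M[R]_(m, n)) (lam : R) : gauge F -> gauge G -> lam != 0 ->
  pair_eigenvalue (F \o mulmx T) G lam ->
  pair_eigenvalue (dual_fun G \o mulmx T^T) (dual_fun F) lam.
Proof.
have comp_sub k l (N : 'cV[R]_k -> R) (A : 'M[R]_(k, l)) :
    sublinear N -> sublinear (N \o mulmx A).
  move=> [hN sN]; split=> [t x t0|x y] /=; first by rewrite -scalemxAr hN.
  by rewrite mulmxDr sN.
move=> gF gG lam0 [x [_ x0 [P [dP [Q dQ QE]]]]]; subst P.
have {dP} /= [PF Px] := (subdiff_sublinear _ _ (comp_sub _ _ _ T gF.2)).1 dP.
have {dQ} [QG Qx] := (subdiff_sublinear _ _ gG.2).1 dQ.
have Gx : 0 < G x := gG.1 x x0.
rewrite dotZl Qx in Px.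
have lam_gt0 : 0 < lam.
  by rewrite lt_neqAle eq_sym lam0 -(pmulr_lge0 _ Gx) Px gauge_ge0.
have FTx : 0 < F (T *m x) by rewrite -Px mulr_gt0.
have [u Tu uF] := hahn_banach gF.2 PF.
have uTx : dot u (T *m x) = F (T *m x) by rewrite -dot_tr Tu dotZl Qx Px.
have u0 : u != 0.
  by apply: contraTneq FTx => u0; rewrite -uTx u0 dot0l ltxx.
have touch k (N : 'cV[R]_k -> R) p y : gauge N -> 0 < N y ->
    (forall z, dot p z <= N z) -> dot p y = N y -> dual_fun N p = 1.
  move=> gN Ny pN py; apply/eqP; rewrite eq_le dual_fun_le//=; last first.
    by move=> z; rewrite mul1r.
  by rewrite -(ler_pM2r Ny) mul1r -{1}py dual_fun_ineq.
(* The eigenvalue [lam] is the Rayleigh quotient of [x], and now of [u]. *)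
have Fu := touch _ _ _ _ gF FTx uF uTx.
have GTu : dual_fun G (T^T *m u) = lam.
  by rewrite Tu (dual_gauge gG).2.1// (touch _ _ _ _ gG Gx QG Qx) mulr1.
exists u; split=> //; exists ((G x)^-1 *: (T *m x)); split.
  apply/subdiff_sublinear; first exact/comp_sub/(dual_gauge gG).2.
  split=> [v|] /=; rewrite dotZl dotC.
    rewrite -dot_tr mulrC ler_pdivrMr//; exact: dual_fun_ineq.
  by rewrite uTx GTu -Px mulrC mulfK// gt_eqF.
exists ((F (T *m x))^-1 *: (T *m x)); last first.
  by rewrite scalerA -Px invfM mulrA divff// mul1r.
apply/subdiff_sublinear; first exact: (dual_gauge gF).2.
split=> [v|]; rewrite dotZl dotC.
  rewrite mulrC ler_pdivrMr//; exact: dual_fun_ineq.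
by rewrite uTx Fu mulVf// gt_eqF.
Qed.

(** As infima over fibres are attained, the unit ball of [Ginf T G] in the range
    of [T] is the image under [T] of the unit ball of [G]. *)
Lemma Ginf_dualE m n (T : 'M[R]_(m, n)) (G : 'cV[R]_n -> R) : gauge G ->
  Ginf_dual T G = dual_fun G \o mulmx T^T.
Proof.
move=> gG; apply/funext => u /=; rewrite /Ginf_dual; set S := [set _ | _ in _].
have leG x : Ginf T G (T *m x) <= G x.
  by apply: ge_inf; [exists 0 => _ [z _ <-]; exact: gauge_ge0|exists x].
have ubS : ubound S (dual_fun G (T^T *m u)).
  move=> _ [_ [[x _ <-] x1] <-]; have [z Kz Gz] := GKer_attained T x gG.
  rewrite -GKer_GinfE -Gz in x1.
  rewrite -[T *m x]addr0 -Kz -mulmxDr -dot_tr (le_trans (dual_fun_ineq _ _ gG))//.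
  by rewrite ler_piMr// dual_fun_ge0.
have S0 : S 0.
  exists 0; last by rewrite dot0r.
  split; first by exists 0; rewrite ?mulmx0.
  by rewrite -(mulmx0 _ T) (le_trans (leG _))// (sublinear0 gG.2).
apply/eqP; rewrite eq_le ge_sup//=; last by exists 0.
apply: dual_fun_le => //; first by apply: ub_le_sup => //; eexists; exact: ubS.
move=> y; have [->|y0] := eqVneq y 0.
  by rewrite dot0r (sublinear0 gG.2) mulr0.
have Gy := gG.1 y y0; rewrite dot_tr -ler_pdivrMr// mulrC -dotZr scalemxAr.
apply: ub_le_sup; first by eexists; exact: ubS.
exists (T *m ((G y)^-1 *: y)) => //; split; first by exists ((G y)^-1 *: y).
by rewrite (le_trans (leG _))// gG.2.1 ?invr_gt0// mulVf// gt_eqF.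
Qed.

End Duality.

(** * Projecting along the kernel *)

Section Projections.
Context {R : realType} {m n : nat}.
Variables (F : 'cV[R]_m -> R) (G : 'cV[R]_n -> R) (T : 'M[R]_(m, n)) (lam : R).

(** The function is constant along [Ker T], so the subgradient inequality at
    [x + z] and [x - z] bounds [dot P z] from both sides. *)
Lemma subdiff_comp_Ker x P z :
  subdiff setT (F \o mulmx T) x P -> Ker T z -> dot P z = 0.
Proof.
move=> [_ dP] Kz; have le0 w : Ker T w -> dot P w <= 0.
  move=> Kw; have := dP (x + w) I.
  by rewrite /= mulmxDr Kw addr0 [x + w]addrC addrK gerDl.
apply/eqP; rewrite eq_le le0//= -oppr_le0 -dotNr le0//.
by rewrite /Ker /= mulmxN Kz oppr0.
Qed.

(** Subgradients of [F \o T] vanish on [Ker T], hence so do those of [G] they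
    are compared with; below such functionals [G] and [GKer T G] are
    interchangeable, once the eigenvector has been moved inside its coset to a
    point where the infimum defining [GKer T G] is attained. *)
Lemma pair_eigenvalue_GKer : gauge G -> lam != 0 ->
  pair_eigenvalue (F \o mulmx T) G lam <->
  pair_eigenvalue_mod (Ker T) (F \o mulmx T) (GKer T G) lam.
Proof.
move=> gG lam0.
have leG x : GKer T G x <= G x.
  apply: ge_inf; first by exists 0 => _ [z _ <-]; exact: gauge_ge0.
  by exists 0; rewrite /Ker /= ?mulmx0 ?addr0.
have QK x Q z : subdiff setT (F \o mulmx T) x (lam *: Q) -> Ker T z ->
    dot Q z = 0.
  move=> dP /(subdiff_comp_Ker dP)/eqP.
  by rewrite dotZl mulf_eq0 (negbTE lam0) => /eqP.
split=> [[x [_ x0 [P [dP [Q dQ QE]]]]]|[x [_ x0 [P [dP [Q dQ QE]]]] KNx]];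
  subst P.
  exists x.
    split=> //; exists (lam *: Q); split=> //; exists Q => //; split=> // y _.
    apply: (@le_trans _ _ (G x + dot Q (y - x))); first by rewrite lerD2r.
    apply: lb_le_inf => [|_ [z Kz <-]].
      by exists (G (y + 0)), 0 => //; rewrite /Ker /= mulmx0.
    rewrite (le_trans _ (dQ.2 (y + z) I))// lerD2l.
    by rewrite addrAC [leRHS]dotDr (QK _ _ _ dP Kz) addr0.
  (* At a nonzero point of the kernel [0 < G x] contradicts [dot Q x = 0]. *)
  move=> Kx; have := dQ.2 0 I; rewrite sub0r dotNr (QK _ _ _ dP Kx).
  by rewrite oppr0 addr0 (sublinear0 gG.2) leNgt gG.1.
have [z Kz Gz] := GKer_attained T x gG.
have Txz : T *m (x + z) = T *m x by rewrite mulmxDr Kz addr0.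
exists (x + z); split=> //.
  by apply: contra_not_neq KNx => xz; rewrite /Ker /= -Txz xz mulmx0.
exists (lam *: Q); split; last exists Q => //; split=> // y _.
  rewrite /= Txz opprD addrA dotBr (subdiff_comp_Ker dP Kz) subr0.
  exact: dP.2.
rewrite Gz opprD addrA dotBr (QK _ _ _ dP Kz) subr0.
exact: le_trans (dQ.2 y I) (leG y).
Qed.

(** Within the subspace [Range T] the chain rule is a mere change of variables,
    in contrast to the full subdifferential in the codomain. *)
Lemma subdiff_comp_Range (H : 'cV[R]_m -> R) x p : Range T p ->
  subdiff (Range T) H (T *m x) p <-> subdiff setT (H \o mulmx T) x (T^T *m p).
Proof.
move=> Rp; split=> [[_ dp]|[_ dp]]; split=> //.
  by move=> y _; rewrite dot_tr mulmxBr; apply: dp; exists y.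
by move=> _ [y _ <-]; rewrite -mulmxBr -dot_tr; exact: dp.
Qed.

(** As [GKer T G] is [Ginf T G \o mulmx T], both members of the projected pair
    are compositions with [T], whose subgradients vanish on [Ker T] and thus
    come from the range of [T]. *)
Lemma pair_eigenvalue_Ginf : lam != 0 ->
  pair_eigenvalue_mod (Ker T) (F \o mulmx T) (GKer T G) lam <->
  pair_eigenvalue_in (Range T) F (Ginf T G) lam.
Proof.
have -> : GKer T G = Ginf T G \o mulmx T by apply/funext => x; exact: GKer_GinfE.
move=> lam0; split=> [[x [_ x0 [P [dP [Q dQ QE]]]] KNx]|]; last first.
  move=> [_ [[x _ <-] Tx0 [p [dp [q dq qE]]]]]; subst p.
  exists x; last exact/eqP.
  split=> //; first by apply: contraNneq Tx0 => ->; rewrite mulmx0.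
  exists (T^T *m (lam *: q)); split.
    by apply/subdiff_comp_Range => //; case: dp.
  exists (T^T *m q); last by rewrite scalemxAr.
  by apply/subdiff_comp_Range => //; case: dq.
subst P; have [q Rq Qq] : exists2 q, Range T q & Q = T^T *m q.
  apply: dot_Ker => z Kz; have /eqP := subdiff_comp_Ker dP Kz.
  by rewrite dotZl mulf_eq0 (negbTE lam0) => /eqP.
have Rlq : Range T (lam *: q).
  by case: Rq => y _ <-; exists (lam *: y); rewrite ?scalemxAr.
exists (T *m x); split; [by exists x|exact/eqP|].
exists (lam *: q); split.
  by apply/subdiff_comp_Range => //; rewrite -scalemxAr -Qq.
by exists q => //; apply/subdiff_comp_Range => //; rewrite -Qq.
Qed.

End Projections.

(** * The five eigenvalue problems *)

Unset Implicit Arguments.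
Set Strict Implicit.

Theorem lemma2p5 (R : realType) (m n : nat)
    (F : 'cV[R]_m -> R) (G : 'cV[R]_n -> R) (T : 'M[R]_(m, n))
    (F_ge0 : forall x, 0 <= F x) (G_ge0 : forall x, 0 <= G x)
    (F_pos : positive_definite F) (G_pos : positive_definite G)
    (F_hom : one_homogeneous F) (G_hom : one_homogeneous G)
    (F_cvx : @convex_function R 'cV[R]_m setT F)
    (G_cvx : @convex_function R 'cV[R]_n setT G)
    (T_neq0 : T != 0) (lam : R) (lam_neq0 : lam != 0) :
  [<-> pair_eigenvalue (F \o mulmx T) G lam;
       pair_eigenvalue (dual_fun G \o mulmx T^T) (dual_fun F) lam;
       pair_eigenvalue_mod (Ker T) (F \o mulmx T) (GKer T G) lam;
       pair_eigenvalue (Ginf_dual T G) (dual_fun F) lam;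
       pair_eigenvalue_in (Range T) F (Ginf T G) lam].
Proof.
have gF := gauge_convex F_pos F_hom F_cvx.
have gG := gauge_convex G_pos G_hom G_cvx.
have E12 : pair_eigenvalue (F \o mulmx T) G lam <->
    pair_eigenvalue (dual_fun G \o mulmx T^T) (dual_fun F) lam.
  split; first exact: pair_eigenvalue_dual.
  move=> /(pair_eigenvalue_dual (dual_gauge gG) (dual_gauge gF) lam_neq0).
  by rewrite trmxK !dual_funK.
have E13 := pair_eigenvalue_GKer F T gG lam_neq0.
have E35 := pair_eigenvalue_Ginf F G T lam_neq0.
rewrite Ginf_dualE//; tfae.
- by move/E12.
- by move/E12/E13.
- by move/E13/E12.
- by move/E12/E13/E35.
- by move/E35/E13.
Qed.
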